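(* Let $n$ be a positive integer. Among all finite groups of order $n$, the abelian group with elementary abelian Sylow subgroups has the highest number of distinct composition series. That is, if $E$ is the (unique up to isomorphism) abelian group of order $n$ all of whose Sylow subgroups are elementary abelian, then for every group $G$ of order $n$, $|\mathcal{C}_G| \le |\mathcal{C}_E|$.
   Context: For a finite group $G$, $\mathcal{C}_G$ denotes the set of all distinct composition series of $G$, i.e. chains of subgroups $\{e\} = G_0 \trianglelefteq G_1 \trianglelefteq \dots \trianglelefteq G_\ell = G$ with each $G_i/G_{i-1}$ simple; two composition series are distinct if they differ as chains of subgroups of $G$ (not merely up to isomorphism). *)

(* Defs.v *)
From mathcomp Require Import all_boot all_fingroup all_solvable.
Set Implicit Arguments.
Unset Strict Implicit.
Unset Printing Implicit Defensive.
Local Open Scope group_scope.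

(* [comps G s] is the library's notion: the chain is listed downwards and its
   top term G is left out, so s = [:: G_(l-1); ...; G_0] with G_0 = 1.  The
   library phrases simplicity of the factors as maximality of each term among
   the proper normal subgroups of the previous one; this is the form with
   normality and simple quotients spelled out. *)
Lemma comps_simple_factors (gT : finGroupType) (G : {group gT})
    (s : seq {group gT}) :
  comps G s = (last G s == 1%G)
    && path [rel H K : {group gT} | (K <| H) && simple (H / K)] G s.
Proof.
rewrite /comps; congr (_ && _).
elim: s G => //= K s IHs G; rewrite IHs; congr (_ && _).
apply/idP/andP=> [maxK | [nKG simpleGK]]; last by rewrite -quotient_simple.
have nKG : K <| G by apply: maxnormal_normal.
by rewrite quotient_simple.
Qed.

Lemma size_comps (gT : finGroupType) (G : {group gT}) (s : seq {group gT}) :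
  comps G s -> size s < #|G|.
Proof.
case/andP=> _; elim: s G => [|K s IHs] G /=; first by rewrite cardG_gt0.
case/andP=> /maxnormal_proper/proper_card ltKG /IHs ltsK.
exact: leq_ltn_trans ltsK ltKG.
Qed.

(* The length bound only serves to make the ambient type finite: by
   [size_comps] it excludes no composition series (see [comp_seriesP]). *)
Definition comp_series (gT : finGroupType) (G : {group gT}) :
    {set #|G|.-bseq {group gT}} :=
  [set s : #|G|.-bseq {group gT} | comps G s].

Lemma comp_seriesP (gT : finGroupType) (G : {group gT})
    (s : seq {group gT}) :
  reflect (exists2 t, t \in comp_series G & s = bseqval t) (comps G s).
Proof.
apply: (iffP idP) => [cGs | [t]]; last by rewrite inE => ? ->.
by exists (Bseq (ltnW (size_comps cGs))); rewrite ?inE.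
Qed.

(* Main.v *)
(** Let c(G) be the number of composition series of G; for G nontrivial it is
    the sum of c(N) over the maximal proper normal subgroups N.  Sort these by
    the smallest prime p dividing |G : N|.  Sending N' to N' :&: N, for a fixed
    N, has fibres of size at most p, so at most 1 + p + ... + p^(a-1) of them
    have index divisible by p, where p^a is the p-part of |G|; for E the
    subgroups of index exactly p attain this bound.  Finally if |N| divides
    |M| with M of index p in E, then M has a subgroup H with |H| = |N|, and
    c(N) <= c(H) <= c(M) by induction on the order and by monotonicity of c
    on the subgroups of E. *)
Require Import Defs.
From mathcomp Require Import all_boot all_fingroup all_solvable.
Local Open Scope group_scope.

Set Implicit Arguments.
Unset Strict Implicit.

(** * Recursion for the number of composition series *)

(** Forgetting the length bound is injective, so series can be counted as plain sequences. *)
Lemma card_comp_series_uniq (gT : finGroupType) (G : {group gT})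
    (l : seq (seq {group gT})) :
  uniq l -> (forall s, (s \in l) = comps G s) -> #|comp_series G| = size l.
Proof.
move=> uniq_l mem_l; rewrite cardE -(size_map val).
apply/perm_size/uniq_perm => // [|s].
  by rewrite map_inj_uniq ?enum_uniq //; apply: val_inj.
rewrite mem_l; apply/mapP/comp_seriesP => [] [t];
  by rewrite ?mem_enum => tG ->; exists t; rewrite ?mem_enum.
Qed.

Lemma card_comp_series1 (gT : finGroupType) (G : {group gT}) :
  G :=: 1 -> #|comp_series G| = 1%N.
Proof.
move=> G1; rewrite (@card_comp_series_uniq _ G [:: [::]]) // => s.
rewrite inE; apply/eqP/idP => [-> | cGs].
  by rewrite /comps /= andbT; apply/eqP/val_inj.
by apply/eqP; rewrite -(trivg_comps cGs) G1.
Qed.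

(** A series of a nontrivial group is not empty: its head is a maximal proper normal subgroup [N],
    and its tail is an arbitrary series of [N]. *)
Lemma card_comp_series_rec (gT : finGroupType) (G : {group gT}) :
  G :!=: 1 ->
  #|comp_series G| = \sum_(N : {group gT} | maxnormal N G G) #|comp_series N|.
Proof.
move=> ntG; pose C (N : {group gT}) := map val (enum (comp_series N)).
have memC N s : (s \in C N) = comps N s.
  apply/mapP/comp_seriesP => [] [t];
    by rewrite ?mem_enum => tG ->; exists t; rewrite ?mem_enum.
pose X := [seq N : {group gT} <- enum {group gT} | maxnormal N G G].
rewrite (@card_comp_series_uniq _ G [seq N :: s | N <- X, s <- C N]).
- rewrite size_allpairs_dep sumnE big_map /X big_filter big_enum_cond.
  by apply: eq_bigr => N _; rewrite size_map -cardE.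
- apply: allpairs_uniq_dep => [|N _|]; first by rewrite filter_uniq ?enum_uniq.
    by rewrite map_inj_uniq ?enum_uniq //; apply: val_inj.
  by move=> [N s] [M t] _ _ /= [-> ->].
move=> s; apply/allpairsPdep/idP => [[N [t []]] | ].
  rewrite mem_filter memC => /andP[maxN _] cNt ->.
  by move: cNt; rewrite /comps /= maxN.
case: s => [/trivg_comps|N s cGs]; first by rewrite (negPf ntG).
exists N, s; rewrite memC (comps_cons cGs) mem_filter mem_enum andbT.
by case/andP: cGs => _ /andP[].
Qed.

(** * Upper bound for maximal normal subgroups of index divisible by [p] *)

(** Distinct maximal normal subgroups generate [G], so the second isomorphism theorem identifies
    [N / (L :&: N)] with the simple group [G / L]. *)
Lemma maxnormal_setI (gT : finGroupType) (G L N : {group gT}) :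
    maxnormal L G G -> maxnormal N G G -> L :!=: N ->
  maxnormal (L :&: N) N N /\ #|N : L :&: N| = #|G : L|.
Proof.
move=> maxL maxN neLN.
have [nsLG nsNG] := (maxnormal_normal maxL, maxnormal_normal maxN).
have defG : N * L = G by apply: maxnormalM => // eqNL; rewrite eqNL eqxx in neLN.
have nLN : N \subset 'N(L) := subset_trans (normal_sub nsNG) (normal_norm nsLG).
have isoQ : N / (L :&: N) \isog G / L.
  by rewrite -defG quotientMidr second_isog.
have nsLN : L :&: N <| N by rewrite setIC (normalGI (normal_sub nsNG) nsLG).
split; first by rewrite -(quotient_simple nsLN) (isog_simple isoQ) quotient_simple.
by rewrite -(card_quotient (normal_norm nsLG)) -(card_isog isoQ) card_quotient
  ?normal_norm.
Qed.

(* Two complements of N / K centralise it and generate G / K, so N / K is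
   central, hence of order p. Every L in the fibre meets the coset N :* g of
   any g outside N in a coset of K, and distinct L give distinct cosets. *)
Lemma card_maxnormal_meet_fibre (gT : finGroupType) (p : nat)
    (G N K : {group gT}) :
    prime p -> maxnormal N G G ->
  #|[set L : {group gT} | [&& maxnormal L G G, (p %| #|G : L|), L != N
                            & (L :&: N)%G == K]]| <= p.
Proof.
move=> p_pr maxN; set F := [set L | _].
have [le1 | /card_gt1P[L1 [L2 [FL1 FL2 neL12]]]] := leqP #|F| 1.
  exact: leq_trans le1 (prime_gt0 p_pr).
have FP (L : {group gT}) : L \in F -> [/\ maxnormal L G G, p %| #|G : L|,
    L :!=: N, L :&: N = K & maxnormal K N N /\ #|N : K| = #|G : L|].
  rewrite inE => /and4P[maxL pL neLN /eqP defK].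
  by have [maxK indK] := maxnormal_setI maxL maxN neLN; rewrite -defK.
have [maxL1 pL1 neL1N defK1 [maxK iK]] := FP _ FL1.
have [maxL2 pL2 neL2N defK2 _] := FP _ FL2.
have nsNG := maxnormal_normal maxN; have nsKN := maxnormal_normal maxK.
have comK (L : {group gT}) : L \in F -> [~: L, N] \subset K.
  case/FP=> maxL _ _ <- _; have nsLG := maxnormal_normal maxL.
  rewrite subsetI commg_subr commg_subl.
  by apply/andP; split; [move: nsLG nsNG | move: nsNG nsLG] => /andP[_ nG] /andP[sG _];
    apply: subset_trans sG nG.
have defG : L1 * L2 = G.
  by apply: maxnormalM => // eqL; rewrite -val_eqE /= eqL eqxx in neL12.
have nsKG : K <| G by rewrite -defK1 normalI // maxnormal_normal.
have nKG := normal_norm nsKG.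
have cNG : G / K \subset 'C(N / K).
  have cLN (L : {group gT}) : L \in F -> L / K \subset 'C(N / K).
    move=> FL; have [maxL _ _ _ _] := FP _ FL.
    rewrite quotient_cents2 ?comK // ?(normal_norm nsKN) //.
    exact: subset_trans (maxnormal_sub maxL) nKG.
  rewrite -{1}defG quotientMl ?(subset_trans (maxnormal_sub maxL1)) //.
  by rewrite mul_subG ?cLN.
have iKp : #|N : K| = p.
  have pr_iK : prime #|N / K|.
    apply: simple_sol_prime; last by rewrite quotient_simple.
    apply: abelian_sol; apply: subset_trans cNG.
    by rewrite quotientS ?normal_sub.
  rewrite card_quotient ?normal_norm // in pr_iK.
  by apply/eqP; rewrite eq_sym -dvdn_prime2 // iK.
have [_ [g Gg notNg]] := properP (maxnormal_proper maxN).
have exh (L : {group gT}) : exists h, L \in F -> h \in N /\ h * g \in L.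
  (* Outside [F] the value 1 is a mere placeholder that makes the choice function total. *)
  have [FL|] := boolP (L \in F); last by exists 1.
  have [maxL _ neLN _ _] := FP _ FL.
  have /mulsgP[x y Nx Ly def_g] : g \in N * L.
    by rewrite (maxnormalM maxN maxL) // => eqNL; rewrite eqNL eqxx in neLN.
  by exists x^-1; rewrite groupV def_g mulKg.
have {exh} [h hP] : exists h, forall L : {group gT}, L \in F ->
    h L \in N /\ h L * g \in L.
  by have [h hP] := fin_all_exists exh; exists h.
pose f (L : {group gT}) := K :* h L.
rewrite -iKp -(@card_in_imset _ _ f) => [|L M FL FM eqLM].
  apply/subset_leq_card/subsetP=> _ /imsetP[L FL ->].
  by rewrite mem_rcosets mulSGid ?normal_sub //; case: (hP L FL).
have [hLN hLg] := hP L FL; have [hMN hMg] := hP M FM.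
apply/eqP; apply: contraR notNg => neLM.
have [maxL pL neLNL defKL _] := FP _ FL.
have [maxM pM neMN defKM _] := FP _ FM.
(* If [L] and [M] differ, [L :&: M] and [K] are both maximal normal in [M], and [K] lies in
   [L :&: M], so they coincide. Equal cosets put [h L * g] in [L :&: M = K], hence in [N], which
   forces [g] into [N]. *)
have [maxLM _] := maxnormal_setI maxL maxM neLM.
have sKL : K \subset L by rewrite -defKL subsetIl.
have sKM : K \subset M by rewrite -defKM subsetIl.
have [maxKM _] := maxnormal_setI maxN maxM (contra_neq esym neMN).
have hLMg : h L * g \in M.
  have: h L \in K :* h M by rewrite -/(f M) -eqLM rcoset_refl.
  case/rcosetP=> k Kk ->; rewrite -mulgA groupMl //.
  exact: (subsetP sKM).
have defI : L :&: M = K.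
  rewrite setIC defKM in maxKM; have [_ maxKM_] := maxgroupP maxKM.
  apply: (maxKM_ (L :&: M)%G); last by rewrite subsetI sKL.
  by rewrite /= (maxnormal_proper maxLM) (normal_norm (maxnormal_normal maxLM)).
have: h L * g \in K by rewrite -defI inE hLg.
by move/(subsetP (normal_sub nsKN)); rewrite groupMl.
Qed.

Lemma card_maxnormal_dvd_index (gT : finGroupType) (p : nat) (G : {group gT}) :
    prime p ->
  #|[set N : {group gT} | maxnormal N G G & p %| #|G : N|]|
    <= \sum_(i < logn p #|G|) p ^ i.
Proof.
move=> p_pr; have [m] := ubnP #|G|; elim: m G => // m IHm G /ltnSE leGm.
set A := [set N | _].
have [-> | [N]] := set_0Vmem A; first by rewrite cards0.
rewrite inE => /andP[maxN pN]; have ltNG := maxnormal_proper maxN.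
have sNG := proper_sub ltNG.
have le_log : logn p #|N| < logn p #|G|.
  rewrite -(Lagrange sNG) lognM ?cardG_gt0 // -addn1 leq_add2l.
  by rewrite -pfactor_dvdn ?expn1.
pose B := [set K : {group gT} | maxnormal K N N & p %| #|N : K|].
have leB : #|B| <= \sum_(i < logn p #|N|) p ^ i.
  by apply: IHm; apply: leq_trans leGm; apply: proper_card.
have leA : #|A :\ N| <= #|B| * p.
  rewrite -sum1_card (partition_big (fun L => (L :&: N)%G) (mem B)) /=.
    rewrite -sum_nat_const; apply: leq_sum => K _.
    apply: leq_trans (card_maxnormal_meet_fibre K p_pr maxN).
    rewrite sum1dep_card; apply/eq_leq/eq_card => L; rewrite !inE.
    by case: (L == N); case: maxnormal; case: (p %| _).
  move=> L; rewrite !inE => /and3P[neLN maxL pL].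
  by have [maxI ->] := maxnormal_setI maxL maxN neLN; rewrite maxI.
(* Counting [N] itself gives 1 + p (1 + ... + p^(b-1)), where p^b is the p-part of |N|; as b < a,
   where p^a is the p-part of |G|, this stays within the bound for [G]. *)
rewrite (cardsD1 N) inE maxN pN.
case: (logn p #|G|) le_log => // a /ltnSE le_a.
rewrite big_ord_recl leq_add2l (leq_trans leA) //.
under eq_bigr do rewrite expnSr; rewrite -big_distrl leq_mul2r /=.
apply/orP; right; apply: (leq_trans leB).
rewrite -!(big_mkord xpredT (fun i => (p ^ i)%N)).
by rewrite [leqRHS](big_cat_nat (leq0n _) le_a) //= leq_addr.
Qed.

(** * Abelian groups with elementary abelian Sylow subgroups *)

Definition abelem_sylows (eT : finGroupType) (E : {group eT}) :=
  abelian E /\ forall (p : nat) (P : {group eT}),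
    prime p -> p.-Sylow(E) P -> p.-abelem P.

Lemma abelem_sylowsS (eT : finGroupType) (E M : {group eT}) :
  M \subset E -> abelem_sylows E -> abelem_sylows M.
Proof.
move=> sME [abE sylE]; split=> [|p P p_pr sylP]; first exact: abelianS abE.
have [Q sylQ sPQ] : {Q : {group eT} | p.-Sylow(E) Q & P \subset Q}.
  apply: Sylow_superset (pHall_pgroup sylP).
  exact: subset_trans (pHall_sub sylP) sME.
exact: abelemS sPQ (sylE _ _ p_pr sylQ).
Qed.

(* Gaschutz' theorem extends the complement of <[x]> from a Sylow p-subgroup
   to E. *)
Lemma abelem_sylows_compl (eT : finGroupType) (E : {group eT}) (p : nat) :
    abelem_sylows E -> prime p -> p %| #|E| ->
  exists x (M : {group eT}), [/\ x \in E, #[x] = p, <[x]> :&: M = 1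
                               & <[x]> * M = E].
Proof.
move=> [abE sylE] p_pr pE; have [x Ex ox] := Cauchy p_pr pE.
have sxE : <[x]> \subset E by rewrite cycle_subG.
have [P sylP sxP] : {P : {group eT} | p.-Sylow(E) P & <[x]> \subset P}.
  by apply: Sylow_superset => //; rewrite /pgroup -orderE ox pnat_id.
have co : coprime #|<[x]>| #|E : P|.
  rewrite -orderE ox prime_coprime // -p'natE //.
  by case/and3P: sylP.
have nsxE : <[x]> <| E by rewrite -sub_abelian_normal.
have := abelem_splits (sylE _ _ p_pr sylP) sxP.
rewrite -(Gaschutz_split nsxE sxP (pHall_sub sylP) (cycle_abelian x) co).
by case/splitsP=> M /complP[tixM defE]; exists x, M.
Qed.

Lemma abelem_sylows_index (eT : finGroupType) (E : {group eT}) (p : nat) :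
    abelem_sylows E -> prime p -> p %| #|E| ->
  exists2 M : {group eT}, M \subset E & #|E : M| = p.
Proof.
move=> eE p_pr pE; have [x [M [Ex ox tixM defE]]] := abelem_sylows_compl eE p_pr pE.
have sME : M \subset E by rewrite -defE mulG_subr.
exists M => //; rewrite -divgS // -defE TI_cardMg // mulnK ?cardG_gt0 //.
Qed.

(** A converse of Lagrange's theorem: as long as the cofactor [k] exceeds 1, one of its prime
    factors is removed by passing to a subgroup of that index. *)
Lemma abelem_sylows_subgroup (eT : finGroupType) (E : {group eT}) (d : nat) :
    abelem_sylows E -> d %| #|E| ->
  exists2 H : {group eT}, H \subset E & #|H| = d.
Proof.
have [m] := ubnP #|E|; elim: m E => // m IHm E /ltnSE leEm eE /dvdnP[k oE].
have [k1 | k_neq1] := eqVneq k 1%N.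
  by exists E => //; rewrite oE k1 mul1n.
have k_gt1 : 1 < k.
  by case: k k_neq1 oE => [|[|k]] // _ /eqP; rewrite mul0n (gtn_eqF (cardG_gt0 E)).
have p_pr := pdiv_prime k_gt1; have pE : pdiv k %| #|E|.
  by rewrite oE dvdn_mulr ?pdiv_dvd.
have [M sME iM] := abelem_sylows_index eE p_pr pE.
have oM : #|M| = (k %/ pdiv k * d)%N.
  apply/eqP; rewrite -(eqn_pmul2r (prime_gt0 p_pr)) -{1}iM Lagrange // oE.
  by rewrite mulnAC divnK ?pdiv_dvd.
have [] := IHm M _ (abelem_sylowsS sME eE) _.
- apply: leq_trans leEm; rewrite -(Lagrange sME) iM.
  by rewrite ltn_Pmulr ?cardG_gt0 ?prime_gt1.
- by rewrite oM dvdn_mull.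
by move=> H sHM oH; exists H => //; apply: subset_trans sHM sME.
Qed.

(* With E = <[x]> \x M, each subgroup K of index p in M, together with some
   m in M outside K of order p, gives the p subgroups K <*> <[m ^+ i * x]> of
   index p in E other than M; they meet M in K and differ for distinct i. *)
Lemma card_index_prime_abelem_sylows (eT : finGroupType) (p : nat)
    (E : {group eT}) :
    prime p -> abelem_sylows E ->
  \sum_(i < logn p #|E|) (p ^ i)%N
    <= #|[set M : {group eT} | M \subset E & #|E : M| == p]|.
Proof.
move=> p_pr; have [m] := ubnP #|E|; elim: m E => // m IHm E /ltnSE leEm eE.
have [pE | pE] := boolP (p %| #|E|); last first.
  by rewrite (eqP (_ : logn p #|E| == 0%N)) ?big_ord0 // -leqn0 leqNgt logn_gt0
    mem_primes p_pr cardG_gt0.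
have [x [M [Ex ox tixM defE]]] := abelem_sylows_compl eE p_pr pE.
have sME : M \subset E by rewrite -defE mulG_subr.
have oE : #|E| = (p * #|M|)%N by rewrite -defE TI_cardMg // -orderE ox.
have notMx : x \notin M.
  apply/negP=> Mx; have: x \in <[x]> :&: M by rewrite inE cycle_id.
  by rewrite tixM inE -order_eq1 ox => /eqP p1; rewrite p1 in p_pr.
have abE : abelian E by case: eE.
have eM := abelem_sylowsS sME eE.
have cE y z : y \in E -> z \in E -> commute y z := (centsP abE y)^~ z.
pose I (A : {group eT}) := [set K : {group eT} | K \subset A & #|A : K| == p].
have exm (K : {group eT}) : exists m, K \in I M -> [/\ m \in M, m ^+ p = 1 & m \notin K].
  have [KI|] := boolP (K \in I M); last by exists 1.
  move: KI; rewrite inE => /andP[sKM /eqP iK].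
  (* A subgroup of index [p] cannot contain a Sylow p-subgroup [P] of [M]; any element of [P]
     outside [K] will do, since [P] has exponent dividing [p]. *)
  have [P sylP] := Sylow_exists p M.
  have : ~~ (P \subset K).
    apply/negP => sPK; case/and3P: sylP => _ _.
    by rewrite p'natE // -(Lagrange_index sKM sPK) iK dvdn_mulr.
  case/subsetPn=> y Py notKy; exists y => _; split=> //.
    exact: subsetP (pHall_sub sylP) y Py.
  have [_ sylE] := eM; have /abelemP[//|_ ->//] := sylE _ _ p_pr sylP.
have {exm} [mu muP] := fin_all_exists exm.
pose y (Ki : {group eT} * 'I_p) := mu Ki.1 ^+ Ki.2 * x.
pose f (Ki : {group eT} * 'I_p) := (Ki.1 <*> <[y Ki]>)%G.
have yP (Ki : {group eT} * 'I_p) : Ki.1 \in I M -> [/\ y Ki \in E, y Ki \notin M & #[y Ki] = p].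
  case: Ki => K i /= KI; have [Mm mp notKm] := muP K KI.
  have Em := subsetP sME _ Mm.
  have notMy : y (K, i) \notin M by rewrite groupMl ?groupX.
  split=> //; first by rewrite groupM ?groupX.
  apply: nt_prime_order => //.
    rewrite expgMn; last by apply: cE; rewrite ?groupX.
    by rewrite -expgM mulnC expgM mp expg1n mul1g -ox expg_order.
  by apply: contraNneq notMy => ->.
have fP (Ki : {group eT} * 'I_p) : Ki.1 \in I M ->
    [/\ f Ki \subset E, f Ki :&: M = Ki.1, #|E : f Ki| = p & y Ki \in f Ki].
  move=> KI; have [Ey notMy oy] := yP Ki KI.
  move: KI; rewrite inE => /andP[sKM /eqP iK].
  have sKE := subset_trans sKM sME.
  have syE : <[y Ki]> \subset E by rewrite cycle_subG.
  have def_f : f Ki = Ki.1 * <[y Ki]> :> {set eT}.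
    by apply: cent_joinEr; apply: (sub_abelian_cent2 abE).
  have tiyM : <[y Ki]> :&: M = 1.
    by apply: prime_TIg; rewrite ?cycle_subG // -orderE oy.
  have sfE : f Ki \subset E by rewrite def_f mul_subG.
  split=> //; first by rewrite def_f -group_modl // tiyM mulg1.
    apply/eqP; rewrite -(eqn_pmul2l (cardG_gt0 (f Ki))) Lagrange // oE.
    rewrite def_f TI_cardMg; last first.
      by apply/trivgP; rewrite -tiyM subsetI subsetIr (subset_trans (subsetIl _ _)).
    by rewrite -orderE oy -(Lagrange sKM) iK mulnC.
  by rewrite def_f (subsetP (mulG_subr _ _)) ?cycle_id.
have iM : #|E : M| = p by rewrite -divgS // oE mulnK.
have injf : {in setX (I M) [set: 'I_p] &, injective f}.
  move=> [K i] [L j] /setXP[/= KI _] /setXP[/= LI _] eqf.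
  have [_ fKM _ fyK] := fP (K, i) KI; have [_ fLM _ fyL] := fP (L, j) LI.
  have eqKL : K = L by apply/val_inj; rewrite /= -fKM -fLM eqf.
  move: eqKL fyL fLM eqf => <- {L LI} fyL fLM eqf; congr pair; apply/val_inj.
  have [Mm mp notKm] := muP K KI.
  move: KI; rewrite inE => /andP[sKM /eqP iK].
  have nKm : mu K \in 'N(K).
    have: M \subset 'N(K) := sub_abelian_norm (abelianS sME abE) sKM.
    by move/subsetP; apply.
  have oKm : #[coset K (mu K)] = p.
    apply: nt_prime_order => //; first by rewrite -morphX // mp morph1.
    by apply: contra notKm => /eqP/coset_idr; apply.
  (* In [y (K, j) * (y (K, i))^-1] the factor [x] cancels, so this quotient lies in both [M] and the
     common value of [f], that is, in [K]. As [mu K] has order [p] modulo [K], the exponents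
     agree. *)
  have: coset K (mu K) ^+ i == coset K (mu K) ^+ j.
    rewrite -!morphX // eq_sym; apply/eqP/rcoset_kercosetP; rewrite ?groupX //.
    rewrite mem_rcoset -fKM inE; apply/andP; split; last first.
      by rewrite groupM ?groupV ?groupX.
    have -> : mu K ^+ j * (mu K ^+ i)^-1 = y (K, j) * (y (K, i))^-1.
      by rewrite /y /= invMg mulgA mulgK.
    by rewrite groupM ?groupV // eqf.
  by rewrite eq_expg_mod_order oKm !modn_small // => /eqP.
rewrite (cardsD1 M) inE sME iM eqxx.
have leM : #|I M| * p <= #|I E :\ M|.
  have -> : (#|I M| * p)%N = #|setX (I M) [set: 'I_p]|.
    by rewrite cardsX cardsT card_ord.
  rewrite -(card_in_imset injf).
  apply/subset_leq_card/subsetP => _ /imsetP[Ki IKi ->].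
  have KI : Ki.1 \in I M by case: (Ki) IKi => K i /setXP[].
  have [sfE _ iE fy] := fP Ki KI; rewrite !inE sfE iE eqxx !andbT.
  by have [_ notMy _] := yP Ki KI; apply: contraNneq notMy => <-.
rewrite oE lognM ?cardG_gt0 ?prime_gt0 // logn_prime // eqxx add1n.
rewrite big_ord_recl leq_add2l; apply: leq_trans leM.
under eq_bigr do rewrite expnSr; rewrite -big_distrl leq_mul2r /=.
apply/orP; right; apply: IHm => //; apply: leq_trans leEm.
by rewrite oE ltn_Pmull ?prime_gt1 ?cardG_gt0.
Qed.

(** * Comparison of the two recursions *)

Lemma abelian_index_prime_maxnormal (gT : finGroupType) (G M : {group gT}) :
  abelian G -> M \subset G -> prime #|G : M| -> maxnormal M G G.
Proof.
move=> abG sMG /(p_index_maximal sMG)/maxgroupP[pMG maxM].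
apply/maxgroupP; split=> [|H /andP[pHG _]]; last exact: maxM.
by rewrite pMG sub_abelian_norm.
Qed.

(** A proper subgroup of [E] is normal, hence lies in some maximal normal [N], whose count is one
    summand of the recursion for [E]. *)
Lemma abelem_sylows_leq_comp_series (eT : finGroupType) (E H : {group eT}) :
  abelem_sylows E -> H \subset E -> #|comp_series H| <= #|comp_series E|.
Proof.
have [m] := ubnP #|E|; elim: m E => // m IHm E /ltnSE leEm eE sHE.
have [pHE | ] := boolP (H \proper E); last first.
  rewrite properEneq sHE andbT negbK => /eqP eqHE.
  by rewrite (val_inj eqHE).
have abE : abelian E by case: eE.
have ntE : E :!=: 1 by rewrite -proper1G (sub_proper_trans (sub1G H)).
have [N maxN sHN] : {N : {group eT} | maxnormal N E E & H \subset N}.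
  by apply: maxgroup_exists; rewrite pHE sub_abelian_norm.
rewrite (card_comp_series_rec ntE) (bigD1 N) //=.
apply: leq_trans (leq_addr _ _); apply: IHm => //.
  exact: leq_trans (proper_card (maxnormal_proper maxN)) leEm.
exact: abelem_sylowsS (maxnormal_sub maxN) eE.
Qed.

(** The largest value of [F] on [A] is attained, hence is at most every [F' j] with [j] in [B];
    multiples of it separate the two sums. *)
Lemma leq_sum_card (I J : finType) (A : {set I}) (B : {set J})
    (F : I -> nat) (F' : J -> nat) :
    #|A| <= #|B| -> (forall i j, i \in A -> j \in B -> F i <= F' j) ->
  \sum_(i in A) F i <= \sum_(j in B) F' j.
Proof.
move=> leAB leF; have [-> | [i0 Ai0]] := set_0Vmem A; first by rewrite big_set0.
case: (arg_maxnP F Ai0) => i Ai maxi.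
apply: (@leq_trans (#|A| * F i)%N); first by rewrite -sum_nat_const leq_sum.
apply: (@leq_trans (#|B| * F i)%N); first by rewrite leq_mul2r leAB orbT.
by rewrite -sum_nat_const leq_sum // => j Bj; apply: leF.
Qed.

Lemma leq_card_comp_series_abelem_sylows (eT gT : finGroupType)
    (E : {group eT}) (G : {group gT}) :
  abelem_sylows E -> #|G| = #|E| -> #|comp_series G| <= #|comp_series E|.
Proof.
have [m] := ubnP #|E|; elim: m eT E gT G => // m IHm eT E gT G /ltnSE leEm eE oGE.
have [G1 | ntG] := eqVneq (G : {set gT}) 1.
  rewrite !card_comp_series1 //; apply/eqP.
  by rewrite trivg_card1 -oGE G1 cards1.
have ntE : E :!=: 1 by rewrite -cardG_gt1 -oGE cardG_gt1.
have abE : abelian E by case: eE.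
rewrite (card_comp_series_rec ntE) (card_comp_series_rec ntG).
(* Ordinals provide a finite type of labels for [partition_big]; no index exceeds |E|, so [inord]
   loses nothing. *)
pose d (N : {group gT}) : 'I_#|E|.+1 := inord (pdiv #|G : N|).
pose d' (M : {group eT}) : 'I_#|E|.+1 := inord #|E : M|.
have dE (N : {group gT}) : d N = pdiv #|G : N| :> nat.
  rewrite inordK // ltnS -oGE (leq_trans (pdiv_leq (indexg_gt0 _ _))) //.
  exact: dvdn_leq (dvdn_indexg _ _).
have d'E (M : {group eT}) : d' M = #|E : M| :> nat.
  by rewrite inordK // ltnS dvdn_leq ?dvdn_indexg.
rewrite (partition_big d predT) // [leqRHS](partition_big d' predT) //=.
apply: leq_sum => p _.
pose A := [set N : {group gT} | maxnormal N G G && (d N == p)].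
pose B := [set M : {group eT} | maxnormal M E E && (d' M == p)].
rewrite (eq_bigl (fun N => N \in A)) => [|N]; last by rewrite inE.
rewrite [leqRHS](eq_bigl (fun M => M \in B)) => [|M]; last by rewrite inE.
have [-> | [N0]] := set_0Vmem A; first by rewrite big_set0.
rewrite inE => /andP[maxN0 /eqP dN0].
have p_pr : prime p.
  by rewrite -dN0 dE pdiv_prime // indexg_gt1 (proper_subn (maxnormal_proper maxN0)).
apply: leq_sum_card => [|N M].
  apply: (@leq_trans (\sum_(i < logn p #|E|) (p ^ i)%N)).
    have := card_maxnormal_dvd_index G p_pr; rewrite [X in logn _ X]oGE; apply: leq_trans.
    apply/subset_leq_card/subsetP => N; rewrite !inE => /andP[-> /eqP dN].
    by rewrite -dN dE pdiv_dvd.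
  apply: leq_trans (card_index_prime_abelem_sylows p_pr eE) _.
  apply/subset_leq_card/subsetP => M; rewrite !inE => /andP[sME /eqP iM].
  rewrite -val_eqE /= d'E iM eqxx andbT.
  by rewrite abelian_index_prime_maxnormal // iM.
rewrite !inE => /andP[maxN /eqP dN] /andP[maxM /eqP dM].
have [sNG sME] := (maxnormal_sub maxN, maxnormal_sub maxM).
have ltME := proper_card (maxnormal_proper maxM).
have eM := abelem_sylowsS sME eE.
(* Here |N| |G : N| = |M| p, and [p] divides |G : N|. *)
have oN : #|N| %| #|M|.
  rewrite -(dvdn_pmul2r (indexg_gt0 E M)) Lagrange // -oGE -(Lagrange sNG).
  by rewrite dvdn_pmul2l ?cardG_gt0 // -d'E dM -dN dE pdiv_dvd.
have [H sHM oH] := abelem_sylows_subgroup eM oN.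
apply: leq_trans (abelem_sylows_leq_comp_series eM sHM).
apply: IHm => //; last exact: abelem_sylowsS sHM eM.
apply: leq_trans leEm; apply: leq_ltn_trans ltME.
exact: subset_leq_card.
Qed.

Unset Implicit Arguments.
Set Strict Implicit.

Theorem theorem2p1 (n : nat) (n_gt0 : 0 < n)
    (eT : finGroupType) (E : {group eT}) (cardE : #|E| = n)
    (abelianE : abelian E)
    (sylowE : forall (p : nat) (P : {group eT}),
       prime p -> p.-Sylow(E) P -> p.-abelem P)
    (gT : finGroupType) (G : {group gT}) (cardG : #|G| = n) :
  #|comp_series G| <= #|comp_series E|.
Proof.
by apply: leq_card_comp_series_abelem_sylows; [split | rewrite cardE].
Qed.
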